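(* Let $\tau_a,\tau_b,\tau_e \in C^0([0,1];[0,+\infty))$ be non-decreasing and assume that at least one of $\tau_a$, $\tau_b$ is not constant. For $(\theta_1,\theta_2)\in S^2$ let $$\tau_\alpha(\theta_1,\theta_2)=\tau_a(1-\theta_2)+\tau_b(\theta_1),\qquad \tau_\beta(\theta_1,\theta_2)=\tau_b(\theta_2)+\tau_a(1-\theta_1),$$ $$\tau_\gamma(\theta_1,\theta_2)=\tau_a(1-\theta_2)+\tau_e(1-\theta_1-\theta_2)+\tau_a(1-\theta_1).$$ If $$\tau_\alpha(1/2,1/2)<\tau_\gamma(0,0)<\tau_\alpha(0,0),$$ then: (i) $\theta^N=(0,0)$ is the unique local Nash point for the five-road network; (ii) the corresponding equilibrium time $\tau_\gamma(0,0)$ is worse (strictly larger) than the mean global travel time of the globally optimal configuration for the four-road network, i.e. $\tau_\gamma(0,0)>\min_{\theta\in[0,1]}T^{\mathrm{IV}}(\theta)$. (That is, the Braess paradox occurs.)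
   Context: $S^2=\{(\theta_1,\theta_2)\in[0,1]^2 : \theta_1+\theta_2\le 1\}$. Five-road network: a unit (normalized) total inflow goes from $A$ to $B$ through two intermediate junctions $P,Q$. Roads: $a$ from $A$ to $P$, $b$ from $P$ to $B$, $c$ from $A$ to $Q$, $d$ from $Q$ to $B$, $e$ from $P$ to $Q$. Roads $a,d$ have the same travel time function $\tau_a$, roads $b,c$ have the same travel time function $\tau_b$, and road $e$ has travel time function $\tau_e$, each being a function of the fraction of the total inflow using the road. The routes are $\alpha=(a,b)$, $\beta=(c,d)$, $\gamma=(a,e,d)$. A state is $(\theta_1,\theta_2)\in S^2$, where $\theta_1,\theta_2$ and $\theta_3=1-\theta_1-\theta_2$ are the fractions of drivers using $\alpha$, $\beta$, $\gamma$ respectively; the route travel times are the $\tau_\alpha,\tau_\beta,\tau_\gamma$ of the claim. Equilibrium state: a state at which all routes with nonzero fraction have the same travel time; this common value is the equilibrium time. Local Nash point (five-road network): an equilibrium state such that there exists $\delta>0$ with the following property: for all $\epsilon\in(0,\delta]$ and all routes $j\neq k$ in $\{\alpha,\beta,\gamma\}$, if moving a fraction $\epsilon$ of drivers from route $k$ to route $j$ gives an admissible state (all three fractions remain in $[0,1]$), then the travel time of route $j$ at the new state is strictly larger than the travel time of route $k$ at the original state. Four-road network: the same network without road $e$ (hence without route $\gamma$). A fraction $\theta\in[0,1]$ uses $\alpha$ and $1-\theta$ uses $\beta$, with travel times $\tau_\alpha^{\mathrm{IV}}(\theta)=\tau_\alpha(\theta,1-\theta)=\tau_a(\theta)+\tau_b(\theta)$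 and $\tau_\beta^{\mathrm{IV}}(\theta)=\tau_\beta(\theta,1-\theta)=\tau_a(1-\theta)+\tau_b(1-\theta)$. Its mean global travel time is $T^{\mathrm{IV}}(\theta)=\theta\,\tau_\alpha^{\mathrm{IV}}(\theta)+(1-\theta)\,\tau_\beta^{\mathrm{IV}}(\theta)$, and a globally optimal configuration is a minimizer of $T^{\mathrm{IV}}$ over $[0,1]$. *)

(* Defs.v *)
From HB Require Import structures.
From mathcomp Require Import all_boot all_order all_algebra.
From mathcomp Require Import all_classical all_reals all_analysis.

Set Implicit Arguments.
Unset Strict Implicit.
Unset Printing Implicit Defensive.

Import Order.TTheory GRing.Theory Num.Theory.
Import numFieldNormedType.Exports.

Local Open Scope classical_set_scope.
Local Open Scope ring_scope.

(* Functions on [0,1] are total functions R -> R constrained only on [0,1]. *)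

(* f belongs to C^0([0,1]; [0,+oo[) and is nondecreasing there. *)
Definition road_time (R : realType) (f : R -> R) : Prop :=
  [/\ {within `[0, 1], continuous f},
      (forall x : R, x \in `[0, 1] -> 0 <= f x) &
      {in `[0, 1] &, {homo f : x y / x <= y}}].

Definition constant_on01 (R : realType) (f : R -> R) : Prop :=
  exists c : R, forall x : R, x \in `[0, 1] -> f x = c.

Inductive route := alpha | beta | gamma.

(* A state is the pair (theta_1, theta_2). *)
Definition S2 (R : realType) : set (R * R) :=
  [set s | [/\ s.1 \in `[0, 1], s.2 \in `[0, 1] & s.1 + s.2 <= 1]].

Definition fraction (R : realType) (s : R * R) (r : route) : R :=
  match r with
  | alpha => s.1
  | beta => s.2
  | gamma => 1 - s.1 - s.2
  end.

Section FiveRoads.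
Context (R : realType) (ta tb te : R -> R).

Definition tau_alpha (s : R * R) : R := ta (1 - s.2) + tb s.1.
Definition tau_beta (s : R * R) : R := tb s.2 + ta (1 - s.1).
Definition tau_gamma (s : R * R) : R :=
  ta (1 - s.2) + te (1 - s.1 - s.2) + ta (1 - s.1).

Definition travel_time (r : route) : R * R -> R :=
  match r with
  | alpha => tau_alpha
  | beta => tau_beta
  | gamma => tau_gamma
  end.

(* t is determined by s: the fractions sum to 1, so some route is used. *)
Definition equilibrium_time (s : R * R) (t : R) : Prop :=
  forall r, fraction s r != 0 -> travel_time r s = t.

Definition equilibrium (s : R * R) : Prop :=
  S2 s /\ exists t, equilibrium_time s t.

Definition indic_route (r i : route) : R :=
  match r, i with
  | alpha, alpha | beta, beta | gamma, gamma => 1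
  | _, _ => 0
  end.

(* Moves a fraction eps from route k to route j; the fraction of gamma, being
   determined by the two others, is updated implicitly. *)
Definition move (k j : route) (eps : R) (s : R * R) : R * R :=
  (s.1 + eps * (indic_route j alpha - indic_route k alpha),
   s.2 + eps * (indic_route j beta - indic_route k beta)).

Definition local_nash (s : R * R) : Prop :=
  equilibrium s /\
  exists2 delta : R, 0 < delta &
    forall eps : R, 0 < eps <= delta ->
    forall j k, j <> k ->
    (forall r, fraction (move k j eps s) r \in `[0, 1]) ->
    travel_time k s < travel_time j (move k j eps s).

End FiveRoads.

Section FourRoads.
Context (R : realType) (ta tb : R -> R).

Definition tau4_alpha (th : R) : R := tau_alpha ta tb (th, 1 - th).
Definition tau4_beta (th : R) : R := tau_beta ta tb (th, 1 - th).

Definition mean_time4 (th : R) : R :=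
  th * tau4_alpha th + (1 - th) * tau4_beta th.

Definition globally_optimal4 (th : R) : Prop :=
  th \in `[0, 1] /\
  forall th' : R, th' \in `[0, 1] -> mean_time4 th <= mean_time4 th'.

End FourRoads.

(* Main.v *)
Require Import Defs.
From mathcomp Require Import all_boot all_order all_algebra.
From mathcomp Require Import all_classical all_reals all_analysis.
From mathcomp Require Import lra.

Import Order.TTheory GRing.Theory Num.Theory.
Import numFieldNormedType.Exports.

Local Open Scope classical_set_scope.
Local Open Scope ring_scope.

(** The upper bound on [tau_gamma ta te (0, 0)] says exactly that
    [ta 1 + te 1 < tb 0]: since the travel times are nondecreasing, going
    through the shortcut [e] and then a road of type [a], both fully loaded, is
    still faster than an empty road of type [b] ([detour_lt_direct]).

    Routes [alpha] and [beta] each differ from [gamma] by using one [b]-road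
    where [gamma] uses the shortcut and an [a]-road.  Hence a driver leaving
    [gamma] always loses, which makes [(0, 0)] a local Nash point
    ([local_nash_origin]); and drivers leaving [alpha] or [beta] for [gamma]
    always gain, however few they are, so that no local Nash point has a driver
    on [alpha] or [beta] ([local_nash_unused]).

    Without the shortcut, the even split makes both routes last
    [tau_alpha ta tb (1 / 2, 1 / 2)], so this is also its mean time, and the
    minimum of the mean time, which exists by continuity, is no larger.  The
    lower bound on [tau_gamma ta te (0, 0)] concludes. *)

Lemma detour_lt_direct {R : realType} {ta tb te : R -> R} :
    road_time ta -> road_time tb -> road_time te -> ta 1 + te 1 < tb 0 ->
  forall x y z : R, x \in `[0, 1] -> y \in `[0, 1] -> z \in `[0, 1] ->
    ta x + te y < tb z.
Proof.
move=> [_ _ ma] [_ _ mb] [_ _ me] gap x y z x01 y01 z01.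
have [i0 i1] : (0 : R) \in `[0, 1] /\ (1 : R) \in `[0, 1].
  by rewrite !in_itv/=; split; lra.
have ax : ta x <= ta 1 by apply: ma => //; move: x01; rewrite in_itv/=; lra.
have ey : te y <= te 1 by apply: me => //; move: y01; rewrite in_itv/=; lra.
have bz : tb 0 <= tb z by apply: mb => //; move: z01; rewrite in_itv/=; lra.
lra.
Qed.

Lemma equilibrium_time_origin (R : realType) (ta tb te : R -> R) :
  equilibrium_time ta tb te (0, 0) (tau_gamma ta te (0, 0)).
Proof. by case; rewrite //= eqxx. Qed.

Lemma local_nash_origin (R : realType) (ta tb te : R -> R) :
    road_time ta -> road_time tb -> road_time te -> ta 1 + te 1 < tb 0 ->
  local_nash ta tb te (0, 0).
Proof.
move=> hta htb hte gap; split; first split.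
- by rewrite /S2 /= !in_itv/=; split; lra.
- by exists (tau_gamma ta te (0, 0)); exact: equilibrium_time_origin.
exists 1 => // eps /andP[eps0 eps1] j k jk adm.
have lt1 z : z \in `[0, 1] -> ta 1 + te 1 < tb z.
  by apply: (detour_lt_direct hta htb hte gap); rewrite in_itv/=; lra.
have /lt1 beps : eps \in `[0, 1] by rewrite in_itv/=; lra.
move: (adm k); rewrite in_itv/=.
(* Only [gamma] has drivers to lose: the other origins are inadmissible. *)
case: k jk adm => jk adm; case: j jk adm => // jk adm;
  rewrite /move /travel_time /tau_alpha /tau_beta /tau_gamma /= => k01;
  try lra; by rewrite !(subr0, mulr0, add0r, mulr1); lra.
Qed.

(** At a local Nash point, every small admissible move must make the drivers
    who change route strictly slower.  A move from [r] to [gamma] makes them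
    faster: the new drivers of [gamma] still share one [a]-road with their
    former route, and the rest of their trip, along [e] and the other [a]-road,
    takes less time than the [b]-road that they left.  So [r] has no drivers
    to move. *)
Lemma local_nash_unused (R : realType) (ta tb te : R -> R) (s : R * R)
    (r : route) :
    road_time ta -> road_time tb -> road_time te -> ta 1 + te 1 < tb 0 ->
    local_nash ta tb te s -> r <> gamma ->
  fraction s r = 0.
Proof.
move=> hta htb hte gap [[S2s _] [delta delta0 nash]] rg.
case: s S2s nash => x y; rewrite /S2 /= !in_itv/= => -[x01 y01 xy1] nash.
have : 0 <= fraction (x, y) r by case: r rg => //= _; lra.
rewrite le_eqVlt => /orP[/eqP //|r0]; exfalso.
set eps := Order.min delta (fraction (x, y) r).
have eps0 : 0 < eps by rewrite lt_min delta0.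
have epsd : eps <= delta by rewrite ge_min lexx.
have epsr : eps <= fraction (x, y) r by rewrite ge_min lexx orbT.
move: (eps) eps0 epsd epsr => e e0 ed er {eps}.
have := nash e _ gamma r (nesym rg); rewrite e0 ed => /(_ isT).
case: r rg r0 er => //= _ r0 er.
- have adm i : fraction (move alpha gamma e (x, y)) i \in `[0, 1].
    by case: i; rewrite in_itv/=; lra.
  move=> /(_ adm); rewrite /tau_alpha /tau_gamma /=.
  rewrite !(subr0, mulr0, addr0, sub0r, mulrN, mulr1).
  have := detour_lt_direct hta htb hte gap (1 - (x - e)) (1 - (x - e) - y) x.
  by rewrite !in_itv/= => H; have := H ltac:(lra) ltac:(lra) ltac:(lra); lra.
- have adm i : fraction (move beta gamma e (x, y)) i \in `[0, 1].
    by case: i; rewrite in_itv/=; lra.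
  move=> /(_ adm); rewrite /tau_beta /tau_gamma /=.
  rewrite !(subr0, mulr0, addr0, sub0r, mulrN, mulr1).
  have := detour_lt_direct hta htb hte gap (1 - (y - e)) (1 - x - (y - e)) y.
  by rewrite !in_itv/= => H; have := H ltac:(lra) ltac:(lra) ltac:(lra); lra.
Qed.

Lemma within_continuous_reflect (R : realType) (f : R -> R) :
  {within `[0, 1], continuous f} ->
  {within `[0, 1], continuous (fun x => f (1 - x))}.
Proof.
move=> /subspace_continuousP cf; apply/subspace_continuousP => x /= x01.
have r01 (y : R) : y \in `[0, 1] -> 1 - y \in `[0, 1].
  by rewrite !in_itv/= => *; lra.
apply: (cvg_comp (fun y => 1 - y) f); last exact: (cf _ (r01 _ x01)).
move=> B /= B1; have : ((fun y : R => 1 - y) @ x --> 1 - x).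
  by apply: cvgB; [exact: cvg_cst|exact: cvg_id].
move=> /(_ _ B1); apply: (@filterS _ (nbhs x)) => y /= By /r01.
exact: By.
Qed.

Lemma mean_time4E (R : realType) (ta tb : R -> R) (th : R) :
  mean_time4 ta tb th =
  th * (ta th + tb th) + (1 - th) * (tb (1 - th) + ta (1 - th)).
Proof. by rewrite /mean_time4 /tau4_alpha /tau4_beta /tau_alpha /= subKr. Qed.

Lemma globally_optimal4_exists (R : realType) (ta tb : R -> R) :
  road_time ta -> road_time tb -> exists th, globally_optimal4 ta tb th.
Proof.
move=> [ca _ _] [cb _ _].
have cid : {within `[0, 1], continuous (fun x : R => x)}.
  by apply: continuous_subspaceT => x; exact: cvg_id.
have cT : {within `[0, 1], continuous (mean_time4 ta tb)}.
  have -> : mean_time4 ta tb = fun th => th * (ta th + tb th) +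
      (1 - th) * (tb (1 - th) + ta (1 - th)).
    by apply/funext => th; exact: mean_time4E.
  move=> x; apply: cvgD; apply: cvgM.
  - exact: cid.
  - by apply: cvgD; [exact: ca|exact: cb].
  - exact: (within_continuous_reflect _ _ cid).
  - by apply: cvgD; [exact: (within_continuous_reflect _ _ cb)|
                     exact: (within_continuous_reflect _ _ ca)].
by have [th th01 th_min] := EVT_min ler01 cT; exists th.
Qed.

Lemma mean_time4_half (R : realType) (ta tb : R -> R) :
  mean_time4 ta tb (1 / 2) = tau_alpha ta tb (1 / 2, 1 / 2).
Proof.
rewrite mean_time4E /tau_alpha /=.
by rewrite (_ : 1 - 1 / 2 = 1 / 2 :> R); lra.
Qed.

Theorem theorem2p7 (R : realType) (ta tb te : R -> R)
    (hta : road_time ta) (htb : road_time tb) (hte : road_time te)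
    (hnc : ~ constant_on01 ta \/ ~ constant_on01 tb)
    (hlt1 : tau_alpha ta tb (1 / 2, 1 / 2) < tau_gamma ta te (0, 0))
    (hlt2 : tau_gamma ta te (0, 0) < tau_alpha ta tb (0, 0)) :
  (local_nash ta tb te (0, 0) /\
   forall s : R * R, local_nash ta tb te s -> s = (0, 0)) /\
  (equilibrium_time ta tb te (0, 0) (tau_gamma ta te (0, 0)) /\
   exists2 th : R, globally_optimal4 ta tb th &
     mean_time4 ta tb th < tau_gamma ta te (0, 0)).
Proof.
have gap : ta 1 + te 1 < tb 0.
  by move: hlt2; rewrite /tau_gamma /tau_alpha /= !subr0; lra.
split; split.
- exact: local_nash_origin.
- case=> x y nash.
  have unused r := local_nash_unused _ _ _ _ _ r hta htb hte gap nash.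
  have /= -> : fraction (x, y) alpha = 0 by exact: unused.
  by have /= -> : fraction (x, y) beta = 0 by exact: unused.
- exact: equilibrium_time_origin.
have [th opt] := globally_optimal4_exists _ _ _ hta htb.
exists th => //; apply: le_lt_trans hlt1; rewrite -mean_time4_half.
by apply: (proj2 opt); rewrite in_itv/=; lra.
Qed.
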